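(* Consider the two-stage game with the linearly weighted reputation payment scheme and the operator's design problem described in the context. Assume that $b\bar x>\sqrt{C\,S(\bar x)}$. Then the choice $\omega=1$ maximizes, over $\omega\in(0,1]$, the operator's expected payoff (with the remaining parameters $h,\gamma$ chosen optimally for each $\omega$). That is, instant payments ($\omega=1$) yield higher payoffs to the operator than payments based on linearly weighted reputations ($\omega<1$).
   Context: An operator hires a sensor for two stages $k=1,2$. Constants: maximal effort $\bar x>0$, unit effort cost $b>0$, verification cost $C>0$, discount factor $\delta\in(0,1)$, reputation weight $\omega$. The operator's benefit $S:[0,\bar x]\to\mathbb R$ is increasing, concave and differentiable with $S(0)=0$; there is $x^*\in[0,\bar x]$ with $\frac{\partial S}{\partial x}(x^* )=b$. The reputation function is $R(z)=hz/\bar x$ with design parameter $h$; a second design parameter is $\gamma\ge0$. At stage $k$ the sensor plays $T$ (exert effort $x_k\in[0,\bar x]$ at cost $bx_k$ and report truthfully) with probability $q_k$, or $NT$ (exert effort $0$, report $\bar x$) with probability $1-q_k$. The operator plays $V$ (verify perfectly at cost $C$) with probability $p_k$, or $NV$ with probability $1-p_k$. The stage score is $r_k=R(x_k)+\gamma$ for $(T,V)$, $r_k=R(x_k)$ for $(T,NV)$, $r_k=0$ for $(NT,V)$, and $r_k=h$ for $(NT,NV)$. Payments to the sensor are $P_1=r_1$ and $P_2=(1-\omega)r_1+\omega r_2$ (the linearly weighted reputation scheme; $\omega=1$ is called instant payments). The sensor's stage payoff is $P_k-bx_k$ under $T$ and $P_k$ under $NT$. The operator's stage payoff is $S(x_k)-P_k$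 under $T$ and $-P_k$ under $NT$, minus $C$ if she verifies. Total utilities $U^S$ (sensor) and $U^P$ (operator) are (stage-1 payoff) $+\,\delta\,\cdot$ (stage-2 payoff). Given $(\omega,h,\gamma)$ and efforts $(x_1,x_2)$, the players play the mixed strategy equilibrium of this game, in which each player is indifferent between their two actions at each stage: $$p_2=\frac{h-R(x_2)+\frac1\omega bx_2}{h+\gamma},\quad p_1=\frac{h-R(x_1)+\frac{1}{1+(1-\omega)\delta}bx_1}{h+\gamma},\quad q_2=\frac{h-\frac1\omega C}{h+\gamma},\quad q_1=\frac{h-\frac{1}{1+(1-\omega)\delta}C}{h+\gamma}.$$ For these strategies to exist the operator has to pick $\omega h>C$. $\mathbb E[U^S(x_1,x_2)]$ and $\mathbb E[U^P(x_1,x_2)]$ denote the expected total utilities under these strategies. If the incentivized effort at some stage is $0$, the operator does not verify at that stage, and that stage is treated as her outside option, contributing $0$ to her utility. Operator's design problem for given $\omega$: choose $h,\gamma\ge0$ and desired efforts $(x_1,x_2)\in[0,\bar x]^2$ to maximize $\mathbb E[U^P(x_1,x_2)]$ subject to - incentive compatibility (IC): $\mathbb E[U^S(x_1,x_2)]\ge\mathbb E[U^S(x_1',x_2')]$ for all $(x_1',x_2')\in[0,\bar x]^2$ (so when the sensor is indifferent between efforts, he takes the one desired by the operator); - individual rationality (IR): $\mathbb E[U^P]\ge0$ and $\mathbb E[U^S]\ge0$. The operator's payoff for a given $\omega$ is her expected payoff $\mathbb E[U^P]$ at the solution of this problem. *)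

(* Defs.v *)
From mathcomp Require Import all_boot all_order all_algebra.
From mathcomp Require Import all_classical all_reals all_analysis.

Set Implicit Arguments.
Unset Strict Implicit.
Unset Printing Implicit Defensive.
Import Order.TTheory GRing.Theory Num.Theory numFieldNormedType.Exports.
Local Open Scope classical_set_scope.
Local Open Scope ring_scope.

(* Derivative relative to a domain: only increments that stay in D are used, so
   on [0, xmax] it is the one-sided derivative at the two endpoints. *)
Definition is_derive_in (R : realType) (D : set R) (f : R -> R) (x l : R) :=
  h^-1 * (f (h + x) - f x) @[h --> within [set h | D (h + x)] 0^'] --> l.

Record game (R : realType) := Game {
  xmax : R;           (* maximal effort *)
  ecost : R;          (* unit effort cost b *)
  vcost : R;          (* verification cost C *)
  disc : R;           (* discount factor delta *)
  benefit : R -> R }. (* S; only its values on [0, xmax] matter *)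

Record design (R : realType) := Design {
  hpar : R;
  gam : R;
  eff1 : R;   (* desired efforts x_1, x_2 *)
  eff2 : R }.

Section Payoffs.
Context {R : realType}.
Implicit Types (G : game R) (omega : R) (d : design R) (x w : R).

Definition reputation G d x : R := hpar d * x / xmax G.

(* A sensor action is t : bool (true for T, false for NT) and an operator
   action is v : bool (true for V, false for NV). *)
Definition score G d x (t v : bool) : R :=
  match t, v with
  | true, true => reputation G d x + gam d
  | true, false => reputation G d x
  | false, true => 0
  | false, false => hpar d
  end.

Definition payment1 (r1 : R) : R := r1.
Definition payment2 omega (r1 r2 : R) : R := (1 - omega) * r1 + omega * r2.

Definition sensor_utility G omega d (t1 v1 t2 v2 : bool) : R :=
  let r1 := score G d (eff1 d) t1 v1 in
  let r2 := score G d (eff2 d) t2 v2 in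
  (payment1 r1 - (if t1 then ecost G * eff1 d else 0))
  + disc G * (payment2 omega r1 r2 - (if t2 then ecost G * eff2 d else 0)).

(* Outside option: a stage with incentivized effort 0 generates no score, hence
   no payment through that score, and no verification; its benefit S(0) is 0.
   The deferred part (1 - omega) * r1 of the second payment is owed for the
   first stage, so it stays due when only the second stage is inactive. *)
Definition if_active (x c : R) : R := if x == 0 then 0 else c.

Definition operator_utility G omega d (t1 v1 t2 v2 : bool) : R :=
  let r1 := if_active (eff1 d) (score G d (eff1 d) t1 v1) in
  let r2 := if_active (eff2 d) (score G d (eff2 d) t2 v2) in
  ((if t1 then benefit G (eff1 d) else 0) - payment1 r1
     - if_active (eff1 d) (if v1 then vcost G else 0))
  + disc G *
    ((if t2 then benefit G (eff2 d) else 0) - payment2 omega r1 r2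
       - if_active (eff2 d) (if v2 then vcost G else 0)).

(* Total weight of the first score in both payments, discounted; the second
   score has weight omega. *)
Definition weight1 G omega : R := 1 + (1 - omega) * disc G.

(* p_k and q_k, for the weight w of the score of stage k. *)
Definition prob_V G d w x : R :=
  (hpar d - reputation G d x + w^-1 * (ecost G * x)) / (hpar d + gam d).
Definition prob_T G d w : R :=
  (hpar d - w^-1 * vcost G) / (hpar d + gam d).

Definition prob (p : R) (a : bool) : R := if a then p else 1 - p.

Definition expected G omega d (U : bool -> bool -> bool -> bool -> R) : R :=
  \sum_(t1 : bool) \sum_(v1 : bool) \sum_(t2 : bool) \sum_(v2 : bool)
    prob (prob_T G d (weight1 G omega)) t1
    * prob (prob_V G d (weight1 G omega) (eff1 d)) v1
    * prob (prob_T G d omega) t2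
    * prob (prob_V G d omega (eff2 d)) v2
    * U t1 v1 t2 v2.

Definition EUS G omega d : R := expected G omega d (sensor_utility G omega d).
Definition EUP G omega d : R := expected G omega d (operator_utility G omega d).

Definition with_efforts d (x1 x2 : R) : design R :=
  Design (hpar d) (gam d) x1 x2.

Definition incentive_compatible G omega d : Prop :=
  forall x1 x2 : R, 0 <= x1 <= xmax G -> 0 <= x2 <= xmax G ->
    EUS G omega (with_efforts d x1 x2) <= EUS G omega d.

Definition individually_rational G omega d : Prop :=
  0 <= EUP G omega d /\ 0 <= EUS G omega d.

(* omega * h > C is what makes q_1 and q_2 positive. *)
Definition feasible G omega d : Prop :=
  [/\ 0 <= hpar d /\ 0 <= gam d,
      0 <= eff1 d <= xmax G /\ 0 <= eff2 d <= xmax G,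
      vcost G < omega * hpar d,
      incentive_compatible G omega d &
      individually_rational G omega d].

Definition solution G omega d : Prop :=
  feasible G omega d /\
  forall d', feasible G omega d' -> EUP G omega d' <= EUP G omega d.

Definition operator_payoff G omega (v : R) : Prop :=
  exists2 d, solution G omega d & v = EUP G omega d.

(* omega0 maximizes the operator's payoff over (0, 1].  As omega * h > C is
   strict, the optimum for some other omega may fail to be attained; the payoff
   at omega0 is therefore compared with every feasible design for omega, in
   particular with a solution when there is one.  If C is too large the design
   problem has no feasible point, for any omega. *)
Definition maximizes_payoff G (omega0 : R) : Prop :=
  0 < omega0 <= 1 /\
  forall omega d, 0 < omega <= 1 -> feasible G omega d ->
    exists2 v, operator_payoff G omega0 v & EUP G omega d <= v.

End Payoffs.

(* Main.v *)
Require Import Defs.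
From mathcomp Require Import all_boot all_order all_algebra.
From mathcomp Require Import all_classical all_reals all_analysis.
From mathcomp Require Import ring lra.
Import Order.TTheory GRing.Theory Num.Theory numFieldNormedType.Exports.
Local Open Scope classical_set_scope.
Local Open Scope ring_scope.

(** Collecting both payments of the first score shows that the two stages
    decouple: each is a copy of one and the same one-stage game, whose only
    trace of omega is the weight w of the score, w = 1 + (1 - omega) delta at
    stage 1 and w = omega at stage 2.  In that game the power to incentivize is
    H = w h, and everything depends on how H compares with the total cost
    K = b xmax of maximal effort.

    Under the equilibrium probabilities the sensor's expected payoff is affine
    in the effort, with a slope of the sign of H - K [sensor_valueE].  Incentive
    compatibility therefore allows a positive effort only if K <= H, and an
    effort below xmax only if H <= K [sensor_value_max].  The operator's payoff
    at an active stage is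
      (H - C) / (H + w gamma) * (S(x) + H (1 - x / xmax)) - H,
    which is best at gamma = 0.  If H > K then x = xmax, and C S(xmax) <= K^2
    makes - C S(xmax) / H - H decreasing for H >= K; so for every weight the
    stage payoff is at most its value at H = K, gamma = 0
    [operator_value_le_critical].  At H = K the sensor is indifferent between
    all efforts, and the best effort for the operator maximizes S(x) - b x,
    which by concavity happens at xstar [concave_le_tangent].

    Hence a stage is worth at most max(0, critical_value xstar), whatever omega.
    For omega < 1 the two stages have different weights, so that no single h
    puts both at H = K.  For omega = 1 both weights are 1, and h = K, gamma = 0
    with effort xstar at both stages (or 0, if the outside option is better)
    attains the bound at both of them.  This design needs C < K, which holds as
    soon as any design is feasible: otherwise each stage would be a loss
    [operator_value_lt0], against individual rationality. *)

(** * Tangents of concave functions *)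

Lemma concave_segment (R : realType) (D : set R) (f : R -> R) (x y t : R) :
  convex_function D (fun z => - f z) -> D x -> D y -> 0 <= t <= 1 ->
  t * (f y - f x) <= f (t * (y - x) + x) - f x.
Proof.
move=> fcvx Dx Dy /andP[t0 t1].
have /= := fcvx (Itv01 t0 t1) y x (mem_set Dy) (mem_set Dx).
rewrite !convRE /= /unstable.onem => h.
have -> : t * (y - x) + x = t * y + (1 - t) * x by ring.
lra.
Qed.

(** On the way from x to y the graph of f stays above its chord, so a first-order
    increment l t (y - x) below t (f y - f x) is impossible for small t.  Only
    increments towards y are used, so x may be an endpoint of the interval. *)
Lemma concave_le_tangent (R : realType) (a b : R) (f : R -> R) (x y l : R) :
  convex_function (`[a, b]%classic : set R) (fun z => - f z) ->
  a <= x <= b -> a <= y <= b -> is_derive_in `[a, b] f x l ->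
  f y - f x <= l * (y - x).
Proof.
move=> fcvx xab yab fl; rewrite leNgt; apply/negP => ltf.
have [yx|nyx] := eqVneq y x; first by move: ltf; rewrite yx !subrr mulr0 ltxx.
have d0 : y - x != 0 by rewrite subr_eq0.
have nd0 : 0 < `|y - x| by rewrite normr_gt0.
pose e := (f y - f x - l * (y - x)) / `|y - x|.
have e0 : 0 < e by rewrite divr_gt0// subr_gt0.
have ed : e * `|y - x| = f y - f x - l * (y - x).
  by rewrite /e divfK// gt_eqF.
(* This e turns an e-close difference quotient, scaled by the chord, into a
   strict contradiction with ltf. *)
have [r /= r0 ball_r] : \forall h \near 0, h != 0 -> a <= h + x <= b ->
    `|l - h^-1 * (f (h + x) - f x)| < e.
  have := fl; move/cvgrPdist_lt/(_ _ e0).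
  rewrite near_withinE near_withinE; apply: filterS => h + h0 hab.
  by apply=> //=; rewrite in_itv.
(* Capped at 1 to stay between x and y, and small enough to stay within r of x. *)
pose t := Num.min 1 (r / (2 * `|y - x|)).
have r2 : 0 < r / (2 * `|y - x|) by rewrite divr_gt0// mulr_gt0.
have t0 : 0 < t by rewrite /t lt_min ltr01.
have t1 : t <= 1 by rewrite /t ge_min lexx.
have tr : t * `|y - x| < r.
  have : t <= r / (2 * `|y - x|) by rewrite /t ge_min lexx orbT.
  rewrite -(ler_pM2r nd0) => /le_lt_trans; apply.
  have -> : r / (2 * `|y - x|) * `|y - x| = r / 2 by field; rewrite gt_eqF.
  lra.
have /(_ _ _ _)/= := ball_r (t * (y - x)).
rewrite /ball_ /= sub0r normrN normrM (gtr0_norm t0) => /(_ tr).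
rewrite mulf_neq0 ?d0 ?(gt_eqF t0)// => /(_ isT).
have tab : a <= t * (y - x) + x <= b by nra.
move=> /(_ tab).
have seg : t * (f y - f x) <= f (t * (y - x) + x) - f x.
  by apply: concave_segment fcvx _ _ _; rewrite /= ?in_itv //= t1 (ltW t0).
set q := (t * (y - x))^-1 * _ => lq.
have qd : f y - f x <= q * (y - x).
  rewrite -(ler_pM2l t0) (le_trans seg)//.
  suff -> : t * (q * (y - x)) = f (t * (y - x) + x) - f x by [].
  by rewrite /q; field; rewrite d0 gt_eqF.
have : (q - l) * (y - x) <= `|l - q| * `|y - x|.
  by rewrite -normrM (le_trans (ler_norm _))// !normrM distrC.
have : `|l - q| * `|y - x| < e * `|y - x| by rewrite ltr_pM2r.
rewrite ed; lra.
Qed.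

(** * Decoupling the stages *)

Section Stages.
Context {R : realType}.
Implicit Types (G : game R) (d : design R) (omega w x y : R).

Definition stage_mean (q p : R) (u : bool -> bool -> R) : R :=
  \sum_(t : bool) \sum_(v : bool) prob q t * prob p v * u t v.

Definition sensor_stage G d w x (t v : bool) : R :=
  w * score G d x t v - (if t then ecost G * x else 0).

Definition operator_stage G d w x (t v : bool) : R :=
  (if t then benefit G x else 0) - w * if_active x (score G d x t v)
  - if_active x (if v then vcost G else 0).

(** The effort x is a parameter separate from d, so that a deviation of the
    sensor changes only this argument. *)
Definition sensor_value G d w x : R :=
  stage_mean (prob_T G d w) (prob_V G d w x) (sensor_stage G d w x).

Definition operator_value G d w x : R :=
  stage_mean (prob_T G d w) (prob_V G d w x) (operator_stage G d w x).

(** The stages are played independently and their probabilities sum to 1, so an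
    expected sum of stage payoffs is the sum of the stage expectations. *)
Lemma expected_additive G omega d (u1 u2 : bool -> bool -> R) (k : R)
    (U : bool -> bool -> bool -> bool -> R) :
  (forall t1 v1 t2 v2, U t1 v1 t2 v2 = u1 t1 v1 + k * u2 t2 v2) ->
  expected G omega d U =
    stage_mean (prob_T G d (weight1 G omega))
      (prob_V G d (weight1 G omega) (eff1 d)) u1
    + k * stage_mean (prob_T G d omega) (prob_V G d omega (eff2 d)) u2.
Proof.
by move=> UE; rewrite /expected /stage_mean !big_bool /= !UE /prob; ring.
Qed.

Lemma EUS_stages G omega d :
  EUS G omega d = sensor_value G d (weight1 G omega) (eff1 d)
                  + disc G * sensor_value G d omega (eff2 d).
Proof.
apply: expected_additive => t1 v1 t2 v2.
by rewrite /sensor_utility /sensor_stage /payment1 /payment2 /weight1; ring.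
Qed.

Lemma EUP_stages G omega d :
  EUP G omega d = operator_value G d (weight1 G omega) (eff1 d)
                  + disc G * operator_value G d omega (eff2 d).
Proof.
apply: expected_additive => t1 v1 t2 v2.
by rewrite /operator_utility /operator_stage /payment1 /payment2 /weight1; ring.
Qed.

Lemma sensor_valueE G d w x :
  w != 0 -> xmax G != 0 -> hpar d + gam d != 0 ->
  sensor_value G d w x =
    hpar d * (w * gam d + (w * hpar d - ecost G * xmax G) * (x / xmax G))
    / (hpar d + gam d).
Proof.
move=> w0 X0 hg0; rewrite /sensor_value /stage_mean !big_bool /= /sensor_stage.
rewrite /prob /score /prob_T /prob_V /reputation.
by field; rewrite ?w0 ?X0 ?hg0.
Qed.

Lemma operator_valueE G d w x :
  w != 0 -> xmax G != 0 -> hpar d + gam d != 0 -> x != 0 ->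
  operator_value G d w x =
    (w * hpar d - vcost G) / (w * (hpar d + gam d))
      * (benefit G x + w * hpar d * (1 - x / xmax G)) - w * hpar d.
Proof.
move=> w0 X0 hg0 x0; rewrite /operator_value /stage_mean !big_bool /=.
rewrite /operator_stage /if_active (negbTE x0).
rewrite /prob /score /prob_T /prob_V /reputation.
by field; rewrite ?w0 ?X0 ?hg0.
Qed.

Lemma operator_value_idle G d w : benefit G 0 = 0 -> operator_value G d w 0 = 0.
Proof.
move=> S0; rewrite /operator_value /stage_mean !big_bool /=.
by rewrite /operator_stage /if_active eqxx S0; ring.
Qed.

(** The stage payoff of the operator when the weighted design parameter w h
    equals b xmax and gamma = 0; it does not depend on w. *)
Definition critical_value G x : R :=
  (1 - vcost G / (ecost G * xmax G))
    * (benefit G x + ecost G * xmax G - ecost G * x) - ecost G * xmax G.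

Lemma operator_value_critical G d w x :
  0 < xmax G -> 0 < ecost G -> 0 < w -> gam d = 0 ->
  w * hpar d = ecost G * xmax G -> x != 0 ->
  operator_value G d w x = critical_value G x.
Proof.
move=> X0 b0 w0 g0 wh x0.
have bX0 : 0 < ecost G * xmax G by rewrite mulr_gt0.
have h0 : 0 < hpar d by rewrite -(pmulr_rgt0 _ w0) wh.
have hg0 : 0 < hpar d + gam d by rewrite g0 addr0.
rewrite operator_valueE ?(gt_eqF w0) ?(gt_eqF X0) ?(gt_eqF hg0)//.
rewrite g0 addr0 wh /critical_value.
by field; rewrite !gt_eqF.
Qed.

(** What feasibility of a design leaves at a single stage of weight w. *)
Definition stage_feasible G d w x : Prop :=
  [/\ 0 < w, 0 <= gam d, 0 <= x <= xmax G, vcost G < w * hpar d &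
    (0 < x -> ecost G * xmax G <= w * hpar d) /\
    (x < xmax G -> w * hpar d <= ecost G * xmax G)].

End Stages.

(** * Upper bounds for a feasible stage *)

Section Bounds.
Set Implicit Arguments.
Context {R : realType} (G : game R).
Context (xmax_gt0 : 0 < xmax G) (ecost_gt0 : 0 < ecost G).
Context (vcost_gt0 : 0 < vcost G) (disc_gt0 : 0 < disc G).
Implicit Types (d : design R) (omega w x y : R).

Local Notation K := (ecost G * xmax G).

Let K_gt0 : 0 < K. Proof. exact: mulr_gt0. Qed.

(** The sensor's value is affine in the effort with a slope of the sign of
    w h - b xmax: comparing x with 0 and with xmax bounds that sign. *)
Lemma sensor_value_max d w x :
  0 < w -> 0 < hpar d -> 0 <= gam d -> 0 <= x <= xmax G ->
  (forall y, 0 <= y <= xmax G -> sensor_value G d w y <= sensor_value G d w x) ->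
  (0 < x -> K <= w * hpar d) /\ (x < xmax G -> w * hpar d <= K).
Proof.
move=> w0 h0 g0 /andP[x0 xX] xmaxi.
have hg0 : 0 < hpar d + gam d by rewrite ltr_wpDr.
have le_drift y : 0 <= y <= xmax G -> 0 <= (w * hpar d - K) * (x - y).
  move=> /xmaxi; rewrite !sensor_valueE ?gt_eqF//.
  rewrite ler_pM2r ?invr_gt0// ler_pM2l// lerD2l -subr_ge0 -mulrBr -mulrBl.
  by rewrite mulrA pmulr_lge0// invr_gt0.
split=> [x_gt0|x_lt].
  have := le_drift 0; rewrite lexx ltW//= subr0 pmulr_lge0// subr_ge0.
  exact.
have := le_drift (xmax G); rewrite lexx ltW//= nmulr_lge0 ?subr_lt0//.
by rewrite subr_le0; exact.
Qed.

(** Deviations of the sensor at one stage only separate the two incentive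
    constraints.  The first weight is at least omega, so omega h > C bounds
    both weighted parameters. *)
Lemma feasible_stages omega d :
  0 < omega <= 1 -> feasible G omega d ->
  stage_feasible G d (weight1 G omega) (eff1 d) /\
  stage_feasible G d omega (eff2 d).
Proof.
move=> /andP[om0 om1] [[h0 g0] [x1 x2] Ch ic _].
have hp : 0 < hpar d by rewrite -(pmulr_rgt0 _ om0) (lt_trans vcost_gt0).
have omw : omega <= weight1 G omega.
  by rewrite (le_trans om1)// /weight1 lerDl mulr_ge0 ?subr_ge0// ltW.
have w0 : 0 < weight1 G omega by rewrite (lt_le_trans om0).
split; split=> //; try by rewrite (lt_le_trans Ch)// ler_pM2r.
  apply: sensor_value_max => // y y_in.
  by have := ic _ _ y_in x2; rewrite !EUS_stages lerD2r.
apply: sensor_value_max => // y y_in.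
by have := ic _ _ x1 y_in; rewrite !EUS_stages lerD2l ler_pM2l.
Qed.

(** Lowering gamma to 0 raises the probability of truthful play.  Then either
    w h = K already, or x = xmax and the payoff falls as w h grows beyond K. *)
Lemma operator_value_le_critical d w x :
  stage_feasible G d w x -> x != 0 -> 0 <= benefit G x ->
  vcost G * benefit G (xmax G) <= K ^+ 2 ->
  operator_value G d w x <= critical_value G x.
Proof.
move=> [w0 g0 /andP[x_ge0 xX] CH [KH HK]] x_neq0 Sx SC.
have x0 : 0 < x by rewrite lt_neqAle eq_sym x_neq0.
move/(_ x0): KH => KH.
have H0 : 0 < w * hpar d by rewrite (lt_trans vcost_gt0).
have h0 : 0 < hpar d by rewrite -(pmulr_rgt0 _ w0).
have hg0 : 0 < hpar d + gam d by rewrite ltr_wpDr.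
rewrite operator_valueE ?gt_eqF//.
have r0 : 0 <= 1 - x / xmax G by rewrite subr_ge0 ler_pdivrMr// mul1r.
have le_gam : (w * hpar d - vcost G) / (w * (hpar d + gam d))
      * (benefit G x + w * hpar d * (1 - x / xmax G)) <=
    (w * hpar d - vcost G) / (w * hpar d)
      * (benefit G x + w * hpar d * (1 - x / xmax G)).
  apply: ler_wpM2r; first by rewrite addr_ge0// mulr_ge0// ltW.
  apply: ler_wpM2l; first by rewrite subr_ge0 ltW.
  rewrite lef_pV2 ?posrE ?mulr_gt0//.
  by rewrite ler_pM2l// lerDl.
apply: le_trans (lerB le_gam (lexx _)) _.
rewrite /critical_value; move: KH HK H0 {le_gam CH}.
set H := w * hpar d => KH HK H0.
have [xltX|Xx] := ltP x (xmax G).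
  have -> : H = K by apply/le_anti; rewrite KH HK.
  set u := (X in X <= _); set v := (X in _ <= X).
  suff -> : u = v by [].
  by rewrite /u /v; field; rewrite !gt_eqF.
have -> : x = xmax G by apply/le_anti; rewrite xX.
move: SC K_gt0 KH; set k := K; set s := benefit G (xmax G).
clearbody H k s => SC k0 kH; rewrite -subr_ge0.
have -> : (1 - vcost G / k) * (s + k - k) - k -
    ((H - vcost G) / H * (s + H * (1 - xmax G / xmax G)) - H) =
    (H - k) * (H * k - vcost G * s) / (H * k).
  by field; rewrite !gt_eqF.
rewrite divr_ge0 ?mulr_ge0 ?subr_ge0 ?(ltW H0) ?(ltW k0)//.
by rewrite (le_trans SC)// expr2 ler_pM2r.
Qed.

(** With K <= C < w h maximal effort is forced, and even the critical value of
    maximal effort is negative. *)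
Lemma operator_value_lt0 d w x :
  stage_feasible G d w x -> 0 <= benefit G (xmax G) ->
  vcost G * benefit G (xmax G) <= K ^+ 2 -> K <= vcost G ->
  operator_value G d w x < 0.
Proof.
move=> fx S_ge0 SC KC.
have xE : x = xmax G.
  case: fx => _ _ /andP[_ xX] CH [_ HK].
  apply/le_anti; rewrite xX leNgt /=; apply/negP => /HK.
  by rewrite leNgt (le_lt_trans KC).
move: fx; rewrite xE => fX.
apply: le_lt_trans (operator_value_le_critical fX _ S_ge0 SC) _.
  by rewrite gt_eqF.
rewrite /critical_value addrK subr_lt0; apply: le_lt_trans (K_gt0).
by apply: mulr_le0_ge0 => //; rewrite subr_le0 ler_pdivlMr ?mul1r.
Qed.

(** An idle stage is worth 0, an active one at most its critical value. *)
Lemma operator_value_le_max d w x m :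
  benefit G 0 = 0 -> stage_feasible G d w x -> 0 <= benefit G x ->
  vcost G * benefit G (xmax G) <= K ^+ 2 ->
  critical_value G x <= m -> operator_value G d w x <= Num.max 0 m.
Proof.
move=> S0 fx Sx SC xm; rewrite le_max.
have [x0|x_neq0] := eqVneq x 0; first by rewrite x0 operator_value_idle ?lexx.
apply/orP; right.
exact: le_trans (operator_value_le_critical fx x_neq0 Sx SC) xm.
Qed.

Lemma feasible_vcost_lt omega d :
  0 < omega <= 1 -> feasible G omega d -> 0 <= benefit G (xmax G) ->
  vcost G * benefit G (xmax G) <= K ^+ 2 -> vcost G < K.
Proof.
move=> om fd S_ge0 SC; rewrite ltNge; apply/negP => KC.
have [f1 f2] := feasible_stages om fd.
case: fd => _ _ _ _ [+ _]; rewrite leNgt => /negP; apply.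
have v1 := operator_value_lt0 f1 S_ge0 SC KC.
have v2 := operator_value_lt0 f2 S_ge0 SC KC.
by rewrite EUP_stages -[ltRHS]addr0 ltrD ?pmulr_rlt0.
Qed.

(** * The critical design at omega = 1 *)

Definition critical_design x : design R := Design K 0 x x.

Let weight1_1 : weight1 G 1 = 1.
Proof. by rewrite /weight1 subrr mul0r addr0. Qed.

Lemma critical_design_EUS x y1 y2 :
  EUS G 1 (with_efforts (critical_design x) y1 y2) = 0.
Proof.
rewrite EUS_stages weight1_1 !sensor_valueE /with_efforts/= ?addr0 ?oner_eq0
  ?gt_eqF//.
by rewrite !mul1r subrr !mul0r addr0 mulr0 mul0r mulr0 addr0.
Qed.

Lemma critical_design_EUP x :
  EUP G 1 (critical_design x) =
  (1 + disc G) * operator_value G (critical_design x) 1 x.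
Proof. by rewrite EUP_stages weight1_1 mulrDl mul1r. Qed.

(** The sensor gets 0 whatever his efforts, so that incentive compatibility
    and his individual rationality hold with equality. *)
Lemma critical_design_feasible x :
  0 <= x <= xmax G -> vcost G < K -> 0 <= EUP G 1 (critical_design x) ->
  feasible G 1 (critical_design x).
Proof.
move=> x_in CK eup_ge0.
have eus0 : EUS G 1 (critical_design x) = 0 := critical_design_EUS x x x.
split; rewrite /= ?mul1r//; first by rewrite (ltW K_gt0).
  by move=> y1 y2 _ _; rewrite critical_design_EUS eus0.
by split; rewrite ?eus0.
Qed.

(** If no effort is worth more than the outside option, the operator leaves
    both stages idle. *)
Lemma critical_design_best x :
  benefit G 0 = 0 ->
  let xopt := if 0 <= critical_value G x then x else 0 in
  operator_value G (critical_design xopt) 1 xopt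
    = Num.max 0 (critical_value G x).
Proof.
move=> S0 /=; case: leP => [crit_ge0|_]; last exact: operator_value_idle.
rewrite operator_value_critical ?mul1r//.
(* At effort 0 the formula still charges C for verification. *)
apply: contraTneq crit_ge0 => ->; rewrite -ltNge /critical_value S0.
suff -> : (1 - vcost G / K) * (0 + K - ecost G * 0) - K = - vcost G.
  by rewrite oppr_lt0.
by field; rewrite !gt_eqF.
Qed.

End Bounds.

(** * Optimality of instant payments *)

Theorem theorem2 (R : realType) (G : game R)
    (xmax_gt0 : 0 < xmax G) (ecost_gt0 : 0 < ecost G) (vcost_gt0 : 0 < vcost G)
    (disc01 : 0 < disc G < 1)
    (benefit_incr :
      {in `[0, xmax G] &, {homo benefit G : x y / x <= y}})
    (benefit_concave :
      convex_function (`[0, xmax G]%classic : set R) (fun x => - benefit G x))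
    (benefit_diff : forall x, 0 <= x <= xmax G ->
      exists l, is_derive_in `[0, xmax G] (benefit G) x l)
    (benefit0 : benefit G 0 = 0)
    (xstar : R) (xstar_in : 0 <= xstar <= xmax G)
    (xstar_opt : is_derive_in `[0, xmax G] (benefit G) xstar (ecost G))
    (cost_large :
      Num.sqrt (vcost G * benefit G (xmax G)) < ecost G * xmax G) :
  maximizes_payoff G 1.
Proof.
have disc0 : 0 < disc G by case/andP: disc01.
have S_ge0 x : 0 <= x <= xmax G -> 0 <= benefit G x.
  move=> /andP[x0 xX]; rewrite -benefit0.
  by apply: benefit_incr; rewrite // ?in_itv /= ?lexx ?x0 ?(ltW xmax_gt0).
have SX : 0 <= benefit G (xmax G) by rewrite S_ge0// lexx ltW.
have SC : vcost G * benefit G (xmax G) <= (ecost G * xmax G) ^+ 2.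
  rewrite -[leLHS]sqr_sqrtr ?mulr_ge0// ?(ltW vcost_gt0)//.
  by rewrite ler_pXn2r ?nnegrE ?sqrtr_ge0 ?mulr_ge0 ?ltW.
split=> [|omega d om fd]; first by rewrite ltr01 lexx.
have CK : vcost G < ecost G * xmax G by exact: (feasible_vcost_lt xmax_gt0 ecost_gt0 vcost_gt0 disc0 om fd).
have crit_max x : 0 <= x <= xmax G ->
    critical_value G x <= critical_value G xstar.
  move=> x_in.
  have tgt := concave_le_tangent _ _ _ _ _ _ _ benefit_concave xstar_in x_in xstar_opt.
  rewrite /critical_value lerD2r ler_wpM2l//; last by lra.
  by rewrite subr_ge0 ler_pdivrMr ?mulr_gt0// mul1r ltW.
pose best := Num.max 0 (critical_value G xstar).
have payoff_le omega' d' : 0 < omega' <= 1 -> feasible G omega' d' ->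
    EUP G omega' d' <= (1 + disc G) * best.
  move=> om' fd'.
  have [f1 f2] := feasible_stages xmax_gt0 vcost_gt0 disc0 om' fd'.
  case: (fd') => _ [x1 x2] _ _ _.
  rewrite EUP_stages mulrDl mul1r lerD// ?ler_pM2l//;
    by apply: operator_value_le_max; rewrite ?S_ge0 ?crit_max.
pose xopt := if 0 <= critical_value G xstar then xstar else 0.
have xopt_in : 0 <= xopt <= xmax G.
  by rewrite /xopt; case: ifP => // _; rewrite lexx ltW.
have eupE : EUP G 1 (critical_design G xopt) = (1 + disc G) * best.
  by rewrite critical_design_EUP critical_design_best.
exists ((1 + disc G) * best); last exact: payoff_le.
exists (critical_design G xopt); last by rewrite eupE.
split=> [|d' fd']; last by rewrite eupE payoff_le// ltr01 lexx.
apply: critical_design_feasible => //.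
by rewrite eupE mulr_ge0 ?addr_ge0 ?(ltW disc0)// /best le_max lexx.
Qed.
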